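(* Let $\{x_1,\dots,x_n\}$ be a linearly independent system of vectors in $H$, let $M:=\operatorname{span}\{x_1,\dots,x_n\}$, and let $x\in H$ with $x\notin M^{\perp}$. Then $$d^2(x,M)\le\frac{\|x\|^2\left[\max_{1\le i\le n}\|x_i\|^2+\left(\sum_{1\le i\ne j\le n}|\langle x_i,x_j\rangle|^2\right)^{1/2}\right]-\sum_{i=1}^n|\langle x,x_i\rangle|^2}{\max_{1\le i\le n}\|x_i\|^2+\left(\sum_{1\le i\ne j\le n}|\langle x_i,x_j\rangle|^2\right)^{1/2}},$$ or, equivalently, $$\Gamma(x_1,\dots,x_n,x)\le\frac{\|x\|^2\left[\max_{1\le i\le n}\|x_i\|^2+\left(\sum_{1\le i\ne j\le n}|\langle x_i,x_j\rangle|^2\right)^{1/2}\right]-\sum_{i=1}^n|\langle x,x_i\rangle|^2}{\max_{1\le i\le n}\|x_i\|^2+\left(\sum_{1\le i\ne j\le n}|\langle x_i,x_j\rangle|^2\right)^{1/2}}\cdot\Gamma(x_1,\dots,x_n).$$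
   Context: $(H;\langle\cdot,\cdot\rangle)$ is an inner product space over the real or complex number field $\mathbb{K}$, with norm $\|x\|=\langle x,x\rangle^{1/2}$. $M^{\perp}$ is the orthogonal complement of $M$ in $H$, and $d(x,M)=\inf_{y\in M}\|x-y\|$ is the distance from $x$ to $M$. For vectors $y_1,\dots,y_m\in H$, $\Gamma(y_1,\dots,y_m)$ denotes the Gram determinant, i.e. the determinant of the $m\times m$ matrix whose $(i,j)$-entry is $\langle y_i,y_j\rangle$. The sum over $1\le i\ne j\le n$ runs over all ordered pairs $(i,j)$ with $i\neq j$; an empty sum is $0$. *)

(* Defs.v *)
(* MathComp world: an abstract realType R and MathComp-real-closed's R[i]. *)
From HB Require Import structures.
From mathcomp Require Import all_boot all_order all_algebra.
From mathcomp Require Import complex.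
From mathcomp Require Import classical_sets reals.

Set Implicit Arguments.
Unset Strict Implicit.
Unset Printing Implicit Defensive.

Import Order.TTheory GRing.Theory Num.Theory.
Local Open Scope classical_set_scope.
Local Open Scope ring_scope.

Variant scalar_kind := RealScalars | ComplexScalars.

Definition scalars (R : realType) (k : scalar_kind) : numFieldType :=
  match k with
  | RealScalars => R
  | ComplexScalars => R[i]
  end.

Section Scalars.
Variable R : realType.

Definition sconj (k : scalar_kind) : scalars R k -> scalars R k :=
  match k with
  | RealScalars => idfun
  | ComplexScalars => Num.conj
  end.

Definition sre (k : scalar_kind) : scalars R k -> R :=
  match k with
  | RealScalars => idfun
  | ComplexScalars => fun z => complex.Re z
  end.

Definition of_real (k : scalar_kind) : R -> scalars R k :=
  match k with
  | RealScalars => idfun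
  | ComplexScalars => fun r => real_complex R r
  end.

(* The norm `|z| of a numFieldType is a nonnegative element of that field. *)
Definition modulus (k : scalar_kind) (z : scalars R k) : R := sre `|z|.

End Scalars.

Arguments sconj : clear implicits.
Arguments of_real {R} k r.

Section InnerProductSpace.
Variables (R : realType) (k : scalar_kind) (H : lmodType (scalars R k)).

Definition lin_indep (n : nat) (X : n.-tuple H) : Prop :=
  forall a : 'I_n -> scalars R k,
    \sum_(i < n) a i *: tnth X i = 0 -> forall i, a i = 0.

Definition lin_span (n : nat) (X : n.-tuple H) : set H :=
  [set y | exists a : 'I_n -> scalars R k, y = \sum_(i < n) a i *: tnth X i].

(* {dot H for theta}: positive definite, linear in the first argument,
   theta-linear in the second, and hermitian with respect to theta. *)
Variable ip : {dot H for sconj R k}.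

Definition ipnorm (x : H) : R := Num.sqrt (sre (ip x x)).

Definition orthocomp (M : set H) : set H :=
  [set x | forall y, M y -> ip x y = 0].

Definition ipdist (x : H) (M : set H) : R :=
  inf [set ipnorm (x - y) | y in M].

Definition Gram (m : nat) (Y : m.-tuple H) : scalars R k :=
  \det (\matrix_(i < m, j < m) ip (tnth Y i) (tnth Y j)).

End InnerProductSpace.

(* Main.v *)
(* Let c_i = <x, x_i>, S = \sum_i |c_i|^2, and let B be the denominator.  Expanding
   the squared norm and applying Cauchy-Schwarz to the off-diagonal part gives
   ||\sum_i c_i x_i||^2 <= S B.  Hence y = B^-1 \sum_i c_i x_i in M satisfies
   ||x - y||^2 <= ||x||^2 - 2 S / B + S / B = ||x||^2 - S / B, which bounds the
   distance.  For Gram determinants, if p is the orthogonal projection of x on M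
   then Gram (x_1, ..., x_n, x) = ||x - p||^2 Gram (x_1, ..., x_n), and
   ||x - p|| <= ||x - y||.  The same identity shows, by induction on n, that the
   Gram determinant of independent vectors is positive, hence that p exists. *)
Require Import Defs.
From HB Require Import structures.
From mathcomp Require Import all_boot all_order all_algebra.
From mathcomp Require Import complex ring.
From mathcomp Require Import classical_sets reals.

Set Implicit Arguments.
Unset Strict Implicit.
Unset Printing Implicit Defensive.

Import Order.TTheory GRing.Theory Num.Theory.
Local Open Scope ring_scope.

(** * Conjugation, modulus and order, uniformly for real and complex scalars *)

Section Scalars.
Variables (R : realType) (k : scalar_kind).
Implicit Types (z : scalars R k) (r s : R).

Fact sconj_is_zmod_morphism : zmod_morphism (sconj R k).
Proof. by case: k => // z w; exact: raddfB. Qed.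

Fact sconj_is_monoid_morphism : monoid_morphism (sconj R k).
Proof.
by case: k => //=; split; [exact: rmorph1 | move=> z w; exact: rmorphM].
Qed.

HB.instance Definition _ :=
  GRing.isZmodMorphism.Build _ _ (sconj R k) sconj_is_zmod_morphism.
HB.instance Definition _ :=
  GRing.isMonoidMorphism.Build _ _ (sconj R k) sconj_is_monoid_morphism.

Fact of_real_is_zmod_morphism : zmod_morphism (@of_real R k).
Proof. by case: k => // r s; exact: (raddfB (real_complex R)). Qed.

Fact of_real_is_monoid_morphism : monoid_morphism (@of_real R k).
Proof.
case: k => //=; split; first exact: (rmorph1 (real_complex R)).
by move=> r s; exact: (rmorphM (real_complex R)).
Qed.

HB.instance Definition _ :=
  GRing.isZmodMorphism.Build _ _ (@of_real R k) of_real_is_zmod_morphism.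
HB.instance Definition _ :=
  GRing.isMonoidMorphism.Build _ _ (@of_real R k) of_real_is_monoid_morphism.

Lemma ler_of_real r s : (of_real k r <= of_real k s) = (r <= s).
Proof. by case: k => //=; rewrite lecR. Qed.

Lemma ltr_of_real r s : (of_real k r < of_real k s) = (r < s).
Proof. by case: k => //=; rewrite ltcR. Qed.

Lemma of_real_sre z : 0 <= z -> of_real k (sre z) = z.
Proof. by case: k z => //= z z0; rewrite RRe_real // ger0_real. Qed.

Lemma of_real_modulus z : of_real k (modulus z) = `|z|.
Proof. exact: of_real_sre. Qed.

Lemma mulr_sconj z : z * sconj R k z = `|z| ^+ 2.
Proof.
by case: k z => /= z; [rewrite real_normK ?num_real ?expr2 | rewrite -normCK].
Qed.

(** Taking norms in z * conj z = |z|^2 and cancelling |z| avoids a case split on the field. *)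
Lemma norm_sconj z : `|sconj R k z| = `|z|.
Proof.
have [->|z0] := eqVneq z 0; first by rewrite rmorph0.
have := congr1 Num.norm (mulr_sconj z).
rewrite normrM normrX normr_id expr2 => /mulfI; apply.
by rewrite normr_eq0.
Qed.

Lemma sconj_ge0 z : 0 <= z -> sconj R k z = z.
Proof.
have [->|z0] := eqVneq z 0; first by rewrite rmorph0.
by move=> /ger0_norm ez; apply: (mulfI z0); rewrite mulr_sconj ez expr2.
Qed.

End Scalars.

(* Weighted AM-GM: 2 A F a b <= F^2 a^2 + A^2 b^2, summed over the indices. *)
Lemma sum_mul_le_sqr (C : numFieldType) (I : finType) (P : pred I)
    (a b : I -> C) (A F : C) :
  (forall i, 0 <= a i) -> (forall i, 0 <= b i) -> 0 <= A -> 0 <= F ->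
  \sum_(i | P i) a i ^+ 2 <= A ^+ 2 -> \sum_(i | P i) b i ^+ 2 <= F ^+ 2 ->
  \sum_(i | P i) a i * b i <= A * F.
Proof.
(* If A = 0 or F = 0, one of the two families vanishes. These cases come first because A F is
   cancelled afterwards. *)
move=> a0 b0; rewrite !le0r => /predU1P[-> _ sa _|A0].
  rewrite mul0r big1 // => i Pi; suff -> : a i = 0 by rewrite mul0r.
  apply/eqP; rewrite -sqrf_eq0 eq_le exprn_ge0 // andbT.
  move: sa; rewrite expr0n /=; apply: le_trans.
  by rewrite (bigD1 i) //= lerDl sumr_ge0 // => j _; rewrite exprn_ge0.
move=> /predU1P[-> _ sb|F0 sa sb].
  rewrite mulr0 big1 // => i Pi; suff -> : b i = 0 by rewrite mulr0.
  apply/eqP; rewrite -sqrf_eq0 eq_le exprn_ge0 // andbT.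
  move: sb; rewrite expr0n /=; apply: le_trans.
  by rewrite (bigD1 i) //= lerDl sumr_ge0 // => j _; rewrite exprn_ge0.
have AF0 : 0 < A * F by exact: mulr_gt0.
rewrite -(ler_pM2l AF0) -(ler_pMn2r (n := 2)) // mulr_sumr -sumrMnl.
have /le_trans : \sum_(i | P i) A * F * (a i * b i) *+ 2 <=
    \sum_(i | P i) (F ^+ 2 * a i ^+ 2 + A ^+ 2 * b i ^+ 2).
  apply: ler_sum => i _.
  rewrite -subr_ge0 (_ : _ - _ = (F * a i - A * b i) ^+ 2).
    by rewrite real_exprn_even_ge0 // realB // ger0_real // mulr_ge0 // ltW.
  by ring.
apply; rewrite big_split /= -!mulr_sumr mulr2n lerD // -expr2 exprMn.
  by rewrite mulrC ler_pM2r // exprn_gt0.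
by rewrite ler_pM2l // exprn_gt0.
Qed.

Section InnerProduct.
Variables (R : realType) (k : scalar_kind) (H : lmodType (scalars R k)).
Variable ip : {dot H for sconj R k}.
Implicit Types (x y u v : H).

Lemma ip_ge0 u : 0 <= ip u u.
Proof.
have [->|/(neq0_dnorm_gt0 (s := ip))/ltW //] := eqVneq u 0.
by rewrite linear0r.
Qed.

Lemma ip_sconj u v : ip u v = sconj R k (ip v u).
Proof. by rewrite hermC expr0 mul1r. Qed.

Lemma sqr_ipnorm u : of_real k (ipnorm ip u ^+ 2) = ip u u.
Proof.
rewrite sqr_sqrtr ?of_real_sre ?ip_ge0 //.
by rewrite -(ler_of_real k) rmorph0 of_real_sre ip_ge0.
Qed.

(** * Approximation of a vector by linear combinations *)

Section Combination.
Variables (n : nat) (Y : 'I_n -> H).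

Lemma ip_lincomb_le (c : 'I_n -> scalars R k) (m f : scalars R k) :
    0 <= f -> (forall i, ip (Y i) (Y i) <= m) ->
    \sum_(p : 'I_n * 'I_n | p.1 != p.2) `|ip (Y p.1) (Y p.2)| ^+ 2 <= f ^+ 2 ->
  ip (\sum_i c i *: Y i) (\sum_i c i *: Y i) <=
    (\sum_i `|c i| ^+ 2) * (m + f).
Proof.
move=> f0 le_m le_f; set u := \sum_i _.
rewrite -[ip u u]ger0_norm ?ip_ge0 //.
have -> : ip u u =
    \sum_(p : 'I_n * 'I_n) c p.1 * sconj R k (c p.2) * ip (Y p.1) (Y p.2).
  rewrite linear_sumlz.
  rewrite -(pair_bigA _ (fun i j => c i * sconj R k (c j) * ip (Y i) (Y j))) /=.
  apply: eq_bigr => i _; rewrite linear_sumr; apply: eq_bigr => j _.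
  by rewrite linearZl_LR linearZr_LR /= mulrA.
apply: le_trans (ler_norm_sum _ _ _) _.
rewrite (bigID (fun p : 'I_n * 'I_n => p.1 == p.2)) /= mulrDr lerD //.
  rewrite (_ : \sum_(p | _) _ = \sum_i `|c i| ^+ 2 * ip (Y i) (Y i)).
    by rewrite mulr_suml ler_sum // => i _; rewrite ler_wpM2l ?exprn_ge0.
  rewrite -(pair_big_dep predT (fun i j => i == j)
    (fun i j => `|c i * sconj R k (c j) * ip (Y i) (Y j)|)) /=.
  apply: eq_bigr => i _; rewrite (big_pred1 i) => [|j]; last by rewrite eq_sym.
  by rewrite !normrM norm_sconj (ger0_norm (ip_ge0 _)) expr2.
under eq_bigr do rewrite 2!normrM norm_sconj.
apply: sum_mul_le_sqr => //; first by move=> p; rewrite mulr_ge0.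
  by rewrite sumr_ge0 // => i _; rewrite exprn_ge0.
(* The square of \sum_i |c_i|^2 is the sum of |c_i|^2 |c_j|^2 over all pairs; the off-diagonal pairs
   give only a part of it. *)
rewrite [leRHS]expr2 mulr_suml.
under [leRHS]eq_bigr do rewrite mulr_sumr.
rewrite (pair_bigA _ (fun i j => `|c i| ^+ 2 * `|c j| ^+ 2)) /=.
under eq_bigr do rewrite exprMn.
rewrite [leRHS](bigID (fun p : 'I_n * 'I_n => p.1 != p.2)) /= lerDl.
by rewrite sumr_ge0 // => p _; rewrite mulr_ge0 ?exprn_ge0.
Qed.

Lemma boas_bellman_approx x (m f : scalars R k) :
    0 <= f -> 0 < m + f -> (forall i, ip (Y i) (Y i) <= m) ->
    \sum_(p : 'I_n * 'I_n | p.1 != p.2) `|ip (Y p.1) (Y p.2)| ^+ 2 <= f ^+ 2 ->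
  exists b : 'I_n -> scalars R k,
    ip (x - \sum_i b i *: Y i) (x - \sum_i b i *: Y i) <=
      (ip x x * (m + f) - \sum_i `|ip x (Y i)| ^+ 2) / (m + f).
Proof.
move=> f0; set B := m + f => B0 le_m le_f.
have := ip_lincomb_le (fun i => ip x (Y i)) f0 le_m le_f.
rewrite -/B; set u := \sum_i _ *: _; set S := \sum_i `|_| ^+ 2; move=> le_u.
(* The factor t = B^-1 minimises ||x||^2 - 2 t S + t^2 S B, which bounds ||x - t u||^2. *)
exists (fun i => B^-1 * ip x (Y i)).
have -> : \sum_i (B^-1 * ip x (Y i)) *: Y i = B^-1 *: u.
  by rewrite scaler_sumr; apply: eq_bigr => i _; rewrite scalerA.
have S0 : 0 <= S by rewrite sumr_ge0 // => i _; rewrite exprn_ge0.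
have xu : ip x u = S.
  rewrite linear_sumr; apply: eq_bigr => i _.
  by rewrite linearZr_LR /= mulrC mulr_sconj.
have ux : ip u x = S by rewrite ip_sconj xu sconj_ge0.
have tB : sconj R k B^-1 = B^-1 by rewrite sconj_ge0 // invr_ge0 ltW.
rewrite linearBl !linearBr !linearZl_LR !linearZr_LR /= xu ux tB.
rewrite mulrBl mulfK ?gt_eqF // -addrA lerD2l [S / B]mulrC -subr_ge0.
rewrite (_ : _ - _ = B^-1 * (S - B^-1 * ip u u)).
  rewrite mulr_ge0 ?invr_ge0 ?(ltW B0) // subr_ge0 ler_pdivrMl //.
  by rewrite mulrC.
by ring.
Qed.

End Combination.

(** * Gram determinants and orthogonal projection *)

Definition gram_mx n (Y : 'I_n -> H) : 'M[scalars R k]_n :=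
  \matrix_(i, j) ip (Y i) (Y j).

(* Subtracting from the last row of the Gram matrix the combination a of the
   other rows is multiplication by a unipotent matrix; by orthogonality the new
   last row vanishes off the diagonal. *)
Lemma det_gram_orth n (Y : 'I_n.+1 -> H) (a : 'I_n -> scalars R k) :
  let r := Y ord_max - \sum_i a i *: Y (lift ord_max i) in
  (forall j, ip r (Y (lift ord_max j)) = 0) ->
  \det (gram_mx Y) = ip r r * \det (gram_mx (Y \o lift ord_max)).
Proof.
move=> r r_orth.
(* The identity matrix, except that its last row is (-a, 1): [unlift] is [None] in the corner, where
   the default 0 keeps the entry 1. *)
pose T : 'M[scalars R k]_n.+1 := \matrix_(i, j)
  ((i == j)%:R - (i == ord_max)%:R * oapp a 0 (unlift ord_max j)).
have detT : \det T = 1.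
  rewrite det_trig; last first.
    apply/is_trig_mxP => i j ij; rewrite mxE.
    rewrite (_ : i == j = false); last by apply/negbTE; rewrite neq_ltn ij.
    rewrite (_ : i == ord_max = false) ?mul0r ?subrr //.
    apply/negbTE; rewrite neq_ltn; apply/orP; left.
    by apply: leq_trans ij _; rewrite -ltnS.
  apply: big1 => i _; rewrite mxE eqxx.
  case: unliftP => [j ->|->] /=; last by rewrite mulr0 subr0.
  by rewrite eq_sym (negbTE (neq_lift _ _)) mul0r subr0.
have rowT i v : \sum_j T i j * ip (Y j) v =
    if i == ord_max then ip r v else ip (Y i) v.
  under eq_bigr do rewrite mxE mulrBl.
  rewrite sumrB (bigD1 i) //= eqxx mul1r [X in _ + X - _]big1 ?addr0; last first.
    by move=> j; rewrite eq_sym => /negbTE ->; rewrite mul0r.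
  have [->|_] := eqVneq i ord_max; last first.
    by rewrite big1 ?subr0 // => j _; rewrite !mul0r.
  rewrite linearBl linear_sumlz; congr (_ - _).
  rewrite (bigD1_ord ord_max) //= unlift_none mulr0 mul0r add0r.
  by apply: eq_bigr => j _; rewrite liftK /= mul1r linearZl_LR.
(* The vectors subtracted from the last one to form r are orthogonal to r. *)
have rr : ip r (Y ord_max) = ip r r.
  rewrite {3}/r linearBr linear_sumr big1 ?subr0 // => j _.
  by rewrite linearZr_LR /= r_orth mulr0.
rewrite -[LHS]mul1r -detT -det_mulmx (expand_det_row _ ord_max).
have TG i j : (T *m gram_mx Y) i j =
    if i == ord_max then ip r (Y j) else ip (Y i) (Y j).
  by rewrite mxE -rowT; apply: eq_bigr => l _; rewrite [gram_mx _ _ _]mxE.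
rewrite (bigD1_ord ord_max) //= big1 ?addr0; last first.
  by move=> j _; rewrite TG eqxx r_orth mul0r.
rewrite TG eqxx rr; congr (_ * _).
rewrite /cofactor addnn -signr_odd odd_double mul1r; congr (\det _).
apply/matrixP => i j; rewrite [LHS]mxE [LHS]mxE TG [RHS]mxE.
by rewrite eq_sym (negbTE (neq_lift _ _)).
Qed.

(** The conditions are the normal equations a G = b with b_j = <x, Y_j>. The unknown a is a row,
    multiplied on the left, because the form is linear in its first argument. *)
Lemma ex_orth_projection n (Y : 'I_n -> H) x : \det (gram_mx Y) != 0 ->
  exists a : 'I_n -> scalars R k,
    forall j, ip (x - \sum_i a i *: Y i) (Y j) = 0.
Proof.
move=> detG; pose b := \row_j ip x (Y j); pose a := b *m invmx (gram_mx Y).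
exists (a 0) => j; apply/eqP; rewrite linearBl subr_eq0 linear_sumlz; apply/eqP.
transitivity ((a *m gram_mx Y) 0 j).
  by rewrite mulmxKV ?mxE // unitmxE unitfE.
rewrite mxE; apply: eq_bigr => i _.
by rewrite linearZl_LR [gram_mx _ _ _]mxE.
Qed.

(** Pythagoras: s - r is a combination of the Y_i, hence orthogonal to r. *)
Lemma ip_sub_projection_le n (Y : 'I_n -> H) x (a b : 'I_n -> scalars R k) :
  let r := x - \sum_i a i *: Y i in let s := x - \sum_i b i *: Y i in
  (forall j, ip r (Y j) = 0) -> ip r r <= ip s s.
Proof.
move=> r s r_orth; pose w := \sum_i (a i - b i) *: Y i.
have -> : s = r + w.
  rewrite /w; under eq_bigr do rewrite scalerBl.
  by rewrite sumrB addrA subrK.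
have rw : ip r w = 0.
  rewrite linear_sumr big1 // => j _.
  by rewrite linearZr_LR /= r_orth mulr0.
have wr : ip w r = 0 by rewrite ip_sconj rw rmorph0.
by clearbody r w; rewrite linearDl !linearDr /= rw wr addr0 add0r lerDl ip_ge0.
Qed.

Lemma det_gram_gt0 n (Y : 'I_n -> H) :
  (forall a, \sum_i a i *: Y i = 0 -> forall i, a i = 0) ->
  0 < \det (gram_mx Y).
Proof.
elim: n Y => [|n IH] Y free; first by rewrite det_mx00 ltr01.
have detG : 0 < \det (gram_mx (Y \o lift ord_max)).
  apply: IH => a a0 i.
  (* A relation among the first n vectors extends by the coefficient 0 on the last one. *)
  have := free (fun j => oapp a 0 (unlift ord_max j)) _ (lift ord_max i).
  rewrite liftK; apply; rewrite (bigD1_ord ord_max) //= unlift_none scale0r add0r.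
  by rewrite -[RHS]a0; apply: eq_bigr => j _; rewrite liftK.
have [a a_orth] := ex_orth_projection (Y ord_max) (lt0r_neq0 detG).
rewrite (det_gram_orth a_orth) mulr_gt0 // neq0_dnorm_gt0 //.
apply/eqP => r0.
(* A zero residual would be a linear relation with coefficient 1 on the last vector. *)
have := free (fun j => oapp (fun i => - a i) 1 (unlift ord_max j)) _ ord_max.
rewrite unlift_none /= => /(_ _)/eqP; rewrite oner_eq0 => /(_ _)/notF; apply.
rewrite (bigD1_ord ord_max) //= unlift_none /= scale1r -[RHS]r0 -sumrN.
by congr (_ + _); apply: eq_bigr => j _; rewrite liftK /= scaleNr.
Qed.

End InnerProduct.

(* The base value 0 of the maximum is harmless: n > 0 follows from
   x \notin M^\perp, and the squared norms are nonnegative.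
   The second inequality is between elements of the scalar field; over R[i],
   a <= b means that Im a = Im b and Re a <= Re b. *)
Theorem theorem2 (R : realType) (k : scalar_kind)
    (H : lmodType (scalars R k)) (ip : {dot H for sconj R k})
    (n : nat) (X : n.-tuple H) (x : H)
    (X_indep : lin_indep X)
    (x_notin : ~ orthocomp ip (lin_span X) x) :
  let B : R :=
    \big[Num.max/0]_(i < n) ipnorm ip (tnth X i) ^+ 2
    + Num.sqrt (\sum_(p : 'I_n * 'I_n | p.1 != p.2)
                  modulus (ip (tnth X p.1) (tnth X p.2)) ^+ 2) in
  let bound : R :=
    (ipnorm ip x ^+ 2 * B - \sum_(i < n) modulus (ip x (tnth X i)) ^+ 2) / B in
  ipdist ip x (lin_span X) ^+ 2 <= bound
  /\ Gram ip [tuple of rcons X x] <= of_real k bound * Gram ip X.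
Proof.
move=> B bound.
pose maxsq := \big[Num.max/0]_(i < n) ipnorm ip (tnth X i) ^+ 2.
pose fro := Num.sqrt (\sum_(p : 'I_n * 'I_n | p.1 != p.2)
                  modulus (ip (tnth X p.1) (tnth X p.2)) ^+ 2).
have of_realB : of_real k B = of_real k maxsq + of_real k fro.
  exact: rmorphD.
have fro0 : 0 <= of_real k fro.
  by rewrite -(rmorph0 (of_real k)) ler_of_real sqrtr_ge0.
have le_max i : ip (tnth X i) (tnth X i) <= of_real k maxsq.
  rewrite -sqr_ipnorm ler_of_real.
  exact: (le_bigmax _ (fun j => ipnorm ip (tnth X j) ^+ 2)).
have le_fro : \sum_(p : 'I_n * 'I_n | p.1 != p.2)
    `|ip (tnth X p.1) (tnth X p.2)| ^+ 2 <= of_real k fro ^+ 2.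
  rewrite -rmorphXn sqr_sqrtr; last first.
    by rewrite sumr_ge0 // => p _; exact: sqr_ge0.
  rewrite rmorph_sum le_eqVlt; apply/orP; left; apply/eqP/eq_bigr => p _.
  by rewrite rmorphXn /= of_real_modulus.
(* If the maximum were 0, every x_i would vanish and x would be orthogonal to M. *)
have B0 : 0 < of_real k maxsq + of_real k fro.
  rewrite ltr_wpDr // lt_neqAle; apply/andP; split; last first.
    by rewrite -(rmorph0 (of_real k)) ler_of_real bigmax_ge_id.
  apply/eqP => max0; apply: x_notin => _ [a ->].
  rewrite linear_sumr big1 // => i _; rewrite linearZr_LR /=.
  suff -> : tnth X i = 0 by rewrite linear0r mulr0.
  apply/eqP/negPn/negP => /(neq0_dnorm_gt0 (s := ip))/lt_geF.
  by rewrite max0 le_max.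
have of_real_bound : of_real k bound =
    (ip x x * (of_real k maxsq + of_real k fro)
       - \sum_i `|ip x (tnth X i)| ^+ 2) / (of_real k maxsq + of_real k fro).
  rewrite fmorph_div rmorphB rmorphM /= -of_realB sqr_ipnorm rmorph_sum.
  congr ((_ - _) / _); apply: eq_bigr => i _.
  by rewrite rmorphXn /= of_real_modulus.
have [b] := boas_bellman_approx x fro0 B0 le_max le_fro.
rewrite -of_real_bound => le_bound; split.
  have dist_ge0 y : 0 <= ipnorm ip y by exact: sqrtr_ge0.
  (* This bound serves twice: the infimum lies below each of the norms, and it is nonnegative, so
     that squares can be compared. *)
  have lb0 : lbound [set ipnorm ip (x - y) | y in lin_span X]%classic 0.
    by move=> _ [y _ <-].
  apply: le_trans (_ : ipnorm ip (x - \sum_i b i *: tnth X i) ^+ 2 <= _).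
    rewrite ler_pXn2r ?nnegrE //.
      apply: ge_inf; first by exists 0.
      by exists (\sum_i b i *: tnth X i) => //; exists b.
    (* The set of norms is nonempty because 0 lies in M. *)
    apply: lb_le_inf => //; exists (ipnorm ip (x - 0)), 0 => //.
    by exists (fun=> 0); rewrite big1 // => i _; rewrite scale0r.
  by rewrite -(ler_of_real k) sqr_ipnorm.
have gram_gt0 := det_gram_gt0 ip X_indep.
have [a a_orth] := ex_orth_projection x (lt0r_neq0 gram_gt0).
have last_rcons : tnth [tuple of rcons X x] ord_max = x.
  by rewrite (tnth_nth x) /= nth_rcons size_tuple ltnn eqxx.
have lift_rcons i : tnth [tuple of rcons X x] (lift ord_max i) = tnth X i.
  by rewrite !(tnth_nth x) lift_max nth_rcons size_tuple ltn_ord.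
have gramX : gram_mx ip (tnth [tuple of rcons X x] \o lift ord_max) =
    gram_mx ip (tnth X).
  by apply/matrixP => i j; rewrite !mxE /= !lift_rcons.
rewrite /Gram -/(gram_mx ip (tnth [tuple of rcons X x])) -/(gram_mx ip (tnth X)).
rewrite (@det_gram_orth _ _ _ _ _ _ a).
  rewrite gramX last_rcons; under eq_bigr do rewrite lift_rcons.
  (* The projection residual is no longer than the residual of the approximation b, whose square is
     at most the bound. *)
  rewrite ler_wpM2r ?(ltW gram_gt0) // (le_trans _ le_bound) //.
  exact: ip_sub_projection_le.
move=> j; rewrite last_rcons lift_rcons.
by under eq_bigr do rewrite lift_rcons.
Qed.
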